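(* There exist absolute constants $c_*>0$, $K>0$ and $p_0$ such that for every prime $p\geqslant p_0$, the number $T(p)$ of ordered triples $(A,B,C)$ of subsets of $\mathbb{F}_p$ such that $x+y\neq z$ for all $x\in A$, $y\in B$, $z\in C$ satisfies $$\bigl|T(p)-3\cdot 4^p-3p\cdot 3^p\bigr|\leqslant K(3-c_* )^p .$$
   Context: $\mathbb{F}_p$ is the field with $p$ elements, viewed as an additive group. The subsets $A,B,C$ may be empty. *)

(* Defs.v *)
From mathcomp Require Import all_boot all_algebra.
Set Implicit Arguments. Unset Strict Implicit. Unset Printing Implicit Defensive.
Import GRing.Theory.

Definition sum_free_triple (p : nat) (t : {set 'F_p} * {set 'F_p} * {set 'F_p}) : bool :=
  [forall x in t.1.1, forall y in t.1.2, forall z in t.2, (x + y)%R != z].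

Definition T (p : nat) : nat :=
  #|[set t : {set 'F_p} * {set 'F_p} * {set 'F_p} | sum_free_triple t]|.

(* Main.v *)
(** Replacing [C] by [- C] turns the condition into [x + y + z <> 0], which is
    symmetric in the three sets.  Triples having a member of size at most 1 give
    the main term up to overlaps of size polynomial times [2 ^ p].

    If [A] contains two points [x <> x'], cut the progression of difference
    [x - x'] into pairs: at most [4 * 8 ^ (p / 2)] pairs [(B, C)] are compatible
    with [A], so the triples with [1 < #|A| < s] are [O(p ^ s * 8 ^ (p / 2))].

    If all three sets have at least [s] elements, [s] a large constant, then
    [(B, C)] is an independent pair of the [s]-regular bipartite graph
    [y + z \in - S] of some [S \subset A] with [#|S| = s].  There are at most
    [p ^ s] graphs, each with at most [(2 + eps) ^ p] independent pairs, and the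
    same holds for [(A, B)] and [(A, C)].  By the Loomis-Whitney inequality the
    number of such triples is at most [p ^ (3 * s / 2) * (2 + eps) ^ (3 * p / 2)],
    and [2 ^ (3 / 2) < 3]. *)

Require Import Defs.
From mathcomp Require Import all_boot all_algebra zify ring.
Set Implicit Arguments. Unset Strict Implicit. Unset Printing Implicit Defensive.
Import GRing.Theory.

(** * Independent pairs in bipartite graphs *)

Lemma leq_sqr_sum (I : finType) (A : {set I}) (d : I -> nat) :
  (\sum_(i in A) d i) ^ 2 <= #|A| * \sum_(i in A) d i ^ 2.
Proof.
rewrite -(leq_pmul2l (ltn0Sn 1)) -mulnn big_distrlr /= big_distrr /=.
under eq_bigr => i _ do rewrite big_distrr /=.
apply: (@leq_trans (\sum_(i in A) \sum_(j in A) (d i ^ 2 + d j ^ 2))).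
  by apply: leq_sum => i _; apply: leq_sum => j _; apply: nat_Cauchy.
under eq_bigr => i _ do rewrite big_split /= sum_nat_const.
rewrite big_split /= sum_nat_const -big_distrr /=; lia.
Qed.

(** Cauchy-Schwarz over the pairs of [P], weighted by their codegree [d]. A codegree is at most both
    degrees, so the sum of its squares is at most the sum of [deg x * deg y] over all pairs, which
    factors as [#|P| ^ 2]. *)
Lemma loomis_whitney (X : finType) (P : {set X * X}) :
  #|[set t : X * X * X |
      [&& (t.1.1, t.1.2) \in P, (t.1.1, t.2) \in P & (t.1.2, t.2) \in P]]| ^ 2
    <= #|P| ^ 3.
Proof.
pose deg x := #|[set z | (x, z) \in P]|.
pose d (e : X * X) := #|[set z | ((e.1, z) \in P) && ((e.2, z) \in P)]|.
have sum_deg : \sum_x deg x = #|P|.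
  rewrite -[RHS]sum1_card; under eq_bigr => x _ do rewrite /deg -sum1_card.
  rewrite pair_big_dep /=; apply: eq_bigl => -[x z]; by rewrite !inE.
have -> : #|[set t : X * X * X |
      [&& (t.1.1, t.1.2) \in P, (t.1.1, t.2) \in P & (t.1.2, t.2) \in P]]|
    = \sum_(e in P) d e.
  rewrite -sum1_card; under [RHS]eq_bigr => x _ do rewrite /d -sum1_card.
  rewrite pair_big_dep /=; apply: eq_bigl => -[[x y] z]; by rewrite !inE.
apply: leq_trans (leq_sqr_sum _ _) _; rewrite [_ ^ 3]expnS leq_mul2l; apply/orP; right.
apply: (@leq_trans (\sum_e deg e.1 * deg e.2)).
  rewrite [leqRHS](bigID (mem P)) /=; apply: leq_trans (leq_addr _ _).
  apply: leq_sum => e _; rewrite -mulnn leq_mul // subset_leq_card //;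
    by apply/subsetP => z; rewrite !inE => /andP[].
rewrite -(pair_bigA _ (fun x y => deg x * deg y)) /= -big_distrlr /= sum_deg.
by rewrite mulnn.
Qed.

(** [N v] is the neighbourhood of [v] in a bipartite graph; [Y] and [Z] are the vertices still
    available on each side, and they shrink as the induction branches. *)
Definition indep_pairs (V W : finType) (N : V -> {set W}) (Y : {set V}) (Z : {set W}) :=
  [set P : {set V} * {set W} |
    [&& P.1 \subset Y, P.2 \subset Z & [forall v in P.1, [disjoint N v & P.2]]]].

(** Branch on whether [v] is chosen. If it is, the other side must avoid [N v], and forgetting [v]
    is injective. *)
Lemma card_indep_pairsD1 (V W : finType) (N : V -> {set W}) (Y : {set V}) (Z : {set W}) v :
  v \in Y ->
  #|indep_pairs N Y Z| <=
    #|indep_pairs N (Y :\ v) Z| + #|indep_pairs N (Y :\ v) (Z :\: N v)|.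
Proof.
move=> vY; rewrite -(cardsID [set P : {set V} * {set W} | v \in P.1]) addnC leq_add //.
  apply/subset_leq_card/subsetP => -[B C]; rewrite !inE /=.
  by case/and4P=> vB BY -> ->; rewrite subsetD1 BY vB.
set f := fun P : {set V} * {set W} => (P.1 :\ v, P.2).
rewrite -(@card_in_imset _ _ f); last first.
  move=> [B C] [B' C']; rewrite !inE /= => /andP[_ vB] /andP[_ vB'] [e ->].
  by rewrite -(setD1K vB) e setD1K.
apply/subset_leq_card/subsetP => _ /imsetP[[B C] + ->]; rewrite !inE /=.
case/andP=> /and3P[BY CZ /forall_inP BC] vB; rewrite setSD //=; apply/andP; split.
  by rewrite subsetD CZ disjoint_sym BC.
by apply/forall_inP => w /setD1P[_ /BC].
Qed.

Lemma card_indep_pairs_max (V W : finType) (N : V -> {set W}) (Y : {set V}) (Z : {set W}) :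
  #|indep_pairs N Y Z| <= 2 ^ (#|Y| + #|Z|).
Proof.
rewrite expnD -!card_powerset -cardsX; apply/subset_leq_card/subsetP => -[B C].
by rewrite !inE /= => /and3P[-> ->].
Qed.

Lemma leq_wexp2r m n e : m <= n -> m ^ e <= n ^ e.
Proof. by case: e => // e mn; rewrite leq_exp2r. Qed.

(** With denominators cleared: a <= (1 + 1/b)^q gives a^r <= (1 + 1/b)^(q r) <= (1 + 1/b)^p. *)
Lemma leq_expn_step a b q r p : a * b ^ q <= b.+1 ^ q -> q * r <= p ->
  a ^ r * b ^ p <= b.+1 ^ p.
Proof.
move=> ab rp; rewrite -(subnKC rp) !expnD mulnA leq_mul ?leq_wexp2r //.
by rewrite !expnM -expnMn leq_wexp2r.
Qed.

(** Double counting of the edges at [Z]: there are at least q k |Z| of them, while a vertex of [Y]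
    meets at most k and any other at most q k. Hence q (|Y| + |Z|) <= q |V| + |Y|. *)
Lemma card_low_degree (V W : finType) (N : V -> {set W}) (k q : nat)
    (Y : {set V}) (Z : {set W}) :
  0 < k -> (forall v, #|N v| <= q * k) -> (forall w, q * k <= #|[set v | w \in N v]|) ->
  (forall v, v \in Y -> #|Z :&: N v| <= k) -> q * (#|Y| + #|Z|) <= q.+1 * #|V|.
Proof.
move=> k0 degV degW lowY; rewrite -(leq_pmul2l k0).
have : \sum_(w in Z) q * k <= \sum_(w in Z) #|[set v | w \in N v]| by exact: leq_sum.
have -> : \sum_(w in Z) #|[set v | w \in N v]| = \sum_v #|Z :&: N v|.
  under eq_bigr => w _ do rewrite -sum1_card.
  under [RHS]eq_bigr => v _ do rewrite -sum1_card.
  rewrite (exchange_big_dep xpredT) //=; apply: eq_bigr => v _.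
  by apply: eq_bigl => w; rewrite !inE.
rewrite (bigID (mem Y)) /= sum_nat_const.
have leY : \sum_(v in Y) #|Z :&: N v| <= #|Y| * k by rewrite -sum_nat_const leq_sum.
have leYC : \sum_(v | v \notin Y) #|Z :&: N v| <= #|~: Y| * (q * k).
  rewrite -sum_nat_const (eq_bigl (mem (~: Y))) => [|v]; last by rewrite !inE.
  by apply: leq_sum => v _; apply: leq_trans (degV v); rewrite subset_leq_card ?subsetIr.
rewrite -(cardsC Y); nia.
Qed.

(** The trivial bound suffices here: |Y| + |Z| exceeds |V| by at most |V| / q, and 2 <= (1 + 1/q)^q
    turns that excess into a factor (1 + 1/q)^|V|. *)
Lemma card_indep_pairs_low_degree (V W : finType) (N : V -> {set W}) (k q : nat)
    (Y : {set V}) (Z : {set W}) :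
  0 < k -> 2 * q ^ q <= q.+1 ^ q ->
  (forall v, #|N v| <= q * k) -> (forall w, q * k <= #|[set v | w \in N v]|) ->
  (forall v, v \in Y -> #|Z :&: N v| <= k) ->
  #|indep_pairs N Y Z| * q ^ #|V| <= (2 * q.+1) ^ #|V|.
Proof.
move=> k0 q2 degV degW /(card_low_degree k0 degV degW) low.
apply: (@leq_trans (2 ^ #|V| * (2 ^ (#|Y| + #|Z| - #|V|) * q ^ #|V|))).
  rewrite mulnA -expnD leq_mul2r (leq_trans (card_indep_pairs_max _ _ _)) ?orbT //.
  by rewrite leq_exp2l //; lia.
by rewrite expnMn leq_mul // (leq_expn_step q2) //; nia.
Qed.

(* Branching on a vertex of degree above [k] into [Z] is paid for by the weight
   [(1 + 1/n) ^ (#|Y| + #|Z|)]. *)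
Lemma card_indep_pairs (V W : finType) (N : V -> {set W}) (n k q : nat)
    (Y : {set V}) (Z : {set W}) :
  0 < k -> n * n ^ k <= n.+1 ^ k -> 2 * q ^ q <= q.+1 ^ q ->
  (forall v, #|N v| <= q * k) -> (forall w, q * k <= #|[set v | w \in N v]|) ->
  #|indep_pairs N Y Z| * n ^ (#|Y| + #|Z|) * q ^ #|V|
    <= (2 * q.+1) ^ #|V| * n.+1 ^ (#|Y| + #|Z|).
Proof.
move=> k0 nk q2 degV degW; move Em: #|Y| => m.
elim: m Y Z Em => [|m IH] Y Z Em.
  all: have [/forall_inP low | ] := boolP [forall v in Y, #|Z :&: N v| <= k].
  1,3: rewrite mulnAC leq_mul ?(card_indep_pairs_low_degree k0) //.
  1,2: exact: leq_wexp2r.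
  1,2: rewrite negb_forall_in => /exists_inP[v vY]; rewrite -ltnNge => high.
  by move: vY; rewrite (cards0_eq Em) inE.
have Em' : #|Y :\ v| = m by move: Em; rewrite (cardsD1 v) vY => -[].
have := IH _ Z Em'; have := IH _ (Z :\: N v) Em'.
have := card_indep_pairsD1 N Z vY.
set i := #|_|; set i1 := #|_|; set i2 := #|_| => le_i.
have eZ : #|Z| = (#|Z :&: N v| - k) + k + #|Z :\: N v|.
  by rewrite subnK ?cardsID // ltnW.
rewrite eZ; move: (_ - k) #|_ :\: _| => t z'.
set Q := q ^ _; set X := _ ^ #|V| => h2 h1.
have -> : m.+1 + (t + k + z') = (m + (t + k + z')).+1 by lia.
rewrite [n.+1 ^ _.+1]expnSr [n ^ _.+1]expnSr.
(* Deleting [v] scales the weight by n / (n + 1); deleting its t + k neighbours in [Z] scales it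
   further by at most 1 / n. The two branches thus add up to n / (n + 1) * (1 + 1/n) = 1. *)
have nt : n * n ^ (t + k) <= n.+1 ^ (t + k).
  by rewrite addnC !expnD mulnA leq_mul // leq_wexp2r.
have e a : a ^ (m + (t + k + z')) = a ^ (t + k) * a ^ (m + z') by rewrite -expnD; congr expn; lia.
move: h1 h2 nt; rewrite !e; move: (n ^ _) (n ^ _) (n.+1 ^ _) (n.+1 ^ _) => b a B A.
move=> h1 h2 nt.
apply: (@leq_trans (n * (i1 * (a * b) * Q) + n * a * (i2 * b * Q))).
  have -> : n * (i1 * (a * b) * Q) + n * a * (i2 * b * Q) = (i1 + i2) * (a * b * n) * Q by ring.
  by rewrite !leq_mul2r le_i !orbT.
apply: leq_trans (leq_add (leq_mul (leqnn n) h1) (leq_mul nt h2)) _.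
by apply: eq_leq; ring.
Qed.

(** * Triples without zero sums *)

Lemma card_bigcup_leq (I T : finType) (P : pred I) (F : I -> {set T}) :
  #|\bigcup_(i | P i) F i| <= \sum_(i | P i) #|F i|.
Proof.
elim/big_rec2: _ => [|i n A _ le_An]; first by rewrite cards0.
by rewrite (leq_trans (leq_card_setU _ _)) // leq_add2l.
Qed.

Lemma card_triples (X Y Z : finType) (E : {set X * Y * Z}) :
  #|E| = \sum_x #|[set w : Y * Z | (x, w.1, w.2) \in E]|.
Proof.
under eq_bigr => x _ do rewrite -sum1_card.
rewrite pair_big_dep /= -sum1_card.
rewrite (reindex (fun q : X * (Y * Z) => (q.1, q.2.1, q.2.2))) /=.
  by apply: eq_bigl => -[x [y z]]; rewrite !inE.
by exists (fun t : X * Y * Z => (t.1.1, (t.1.2, t.2))) => [[x [y z]]|[[x y] z]].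
Qed.

Lemma bin_leq_expn n k : 'C(n, k) <= n ^ k.
Proof.
apply: (@leq_trans (n ^_ k)); first by rewrite -bin_ffact leq_pmulr ?fact_gt0.
rewrite ffact_prod -[k in leqRHS]card_ord -prod_nat_const.
by apply: leq_prod => i _; apply: leq_subr.
Qed.

Lemma card_subsets_lt (X : finType) s : 0 < #|X| ->
  #|[set A : {set X} | #|A| < s]| <= s * #|X| ^ s.
Proof.
move=> X0; apply: (@leq_trans #|\bigcup_(i < s) [set A : {set X} | #|A| == i]|).
  apply/subset_leq_card/subsetP => A; rewrite inE => As.
  by apply/bigcupP; exists (Ordinal As); rewrite ?inE.
apply: leq_trans (card_bigcup_leq _ _) _; rewrite -[s in leqRHS]card_ord -sum_nat_const.
apply: leq_sum => i _; rewrite card_draws (leq_trans (bin_leq_expn _ _)) //.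
by rewrite card_ord leq_pexp2l // ltnW.
Qed.

(** Bernoulli's inequality 1 + m/n <= (1 + 1/n)^m without denominators. *)
Lemma bernoulli_expn n m : n ^ m * (n + m) <= n.+1 ^ m * n.
Proof. by elim: m => [|m IH]; rewrite ?addn0 // !expnSr; nia. Qed.

Lemma double_expn n : 0 < n -> 2 * n ^ n <= n.+1 ^ n.
Proof. by move=> n0; have := bernoulli_expn n n; nia. Qed.

(** Since (1 + 1/n)^(n^2) >= 2^n > n, the threshold k = n^2 meets the branching condition of
    [card_indep_pairs]. *)
Lemma expn_sqr_step n : 0 < n -> n * n ^ (n ^ 2) <= n.+1 ^ (n ^ 2).
Proof.
move=> n0; rewrite -mulnn !expnM; have := leq_wexp2r n (double_expn n0).
by rewrite expnMn; apply: leq_trans; rewrite leq_mul2r ltnW ?orbT // ltn_expl.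
Qed.

Definition zero_free (G : finZmodType) (A B C : {set G}) : bool :=
  [forall x in A, forall y in B, forall z in C, (x + y + z)%R != 0%R].

Section ZeroFree.

Variable G : finZmodType.
Implicit Types (A B C S : {set G}) (x y z : G).

Lemma zero_freeP A B C :
  reflect (forall x y z, x \in A -> y \in B -> z \in C -> (x + y + z)%R != 0%R)
          (zero_free A B C).
Proof.
apply: (iffP forall_inP) => [h x y z xA yB zC | h x xA].
  by have /forall_inP/(_ y yB)/forall_inP/(_ z zC) := h x xA.
by apply/forall_inP => y yB; apply/forall_inP => z zC; apply: h.
Qed.

Lemma zero_free_perm12 A B C : zero_free A B C = zero_free B A C.
Proof.
by apply/zero_freeP/zero_freeP => h x y z xA yB zC; rewrite [(x + y)%R]addrC h.
Qed.

Lemma zero_free_perm23 A B C : zero_free A B C = zero_free A C B.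
Proof. by apply/zero_freeP/zero_freeP => h x y z xA yB zC; rewrite addrAC h. Qed.

Definition nbhd S y : {set G} := [set z | (- (y + z))%R \in S].

Lemma card_nbhd S y : #|nbhd S y| = #|S|.
Proof.
rewrite -[RHS](@card_imset _ _ (fun a => - (y + a))%R); last first.
  by move=> a b /oppr_inj /addrI.
apply: eq_card => z; rewrite inE; apply/idP/imsetP => [zS | [a aS ->]].
  by exists (- (y + z))%R; rewrite // opprD opprK addKr.
by rewrite opprD opprK addKr.
Qed.

Lemma zero_free_nbhd S A B C : S \subset A -> zero_free A B C ->
  (B, C) \in indep_pairs (nbhd S) setT setT.
Proof.
move=> /subsetP SA /zero_freeP h; rewrite inE !subsetT /=.
apply/forall_inP => y yB; rewrite disjoints_subset; apply/subsetP => z.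
rewrite !inE => zS; apply/negP => zC; have := h _ _ _ (SA _ zS) yB zC.
by rewrite -addrA addNr eqxx.
Qed.

(** A single set containing all three projections of the large triples, so that [loomis_whitney]
    applies with one [P]. *)
Definition extendable_pairs (s : nat) : {set {set G} * {set G}} :=
  [set P | [exists A : {set G}, (s <= #|A|) && zero_free A P.1 P.2]].

(** Shrink the extending set to exactly n^3 elements and take a union bound over the at most
    |G|^(n^3) choices. Each graph has at most (2 (1 + 1/n)^3)^|G| independent pairs: one factor 1 +
    1/n comes from the low-degree bound, two from the weight with |Y| + |Z| = 2 |G|. *)
Lemma card_extendable_pairs n : 0 < n ->
  #|extendable_pairs (n ^ 3)| * (n ^ 3) ^ #|G|
    <= #|G| ^ (n ^ 3) * (2 * n.+1 ^ 3) ^ #|G|.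
Proof.
move=> n0; set s := n ^ 3.
apply: (@leq_trans (#|\bigcup_(S in [set S : {set G} | #|S| == s])
                       indep_pairs (nbhd S) setT setT| * s ^ #|G|)).
  rewrite leq_mul2r; apply/orP; right.
  apply/subset_leq_card/subsetP => -[B C]; rewrite inE => /existsP[A /andP[/card_geqP]].
  move=> [l [Ul sl lA]] ABC; apply/bigcupP; exists [set x in l].
    by rewrite inE cardsE (card_uniqP Ul) sl.
  by apply: zero_free_nbhd ABC; apply/subsetP => x; rewrite inE => /lA.
apply: (@leq_trans (\sum_(S in [set S : {set G} | #|S| == s]) (2 * n.+1 ^ 3) ^ #|G|)).
  apply: leq_trans (leq_mul (card_bigcup_leq _ _) (leqnn _)) _.
  rewrite big_distrl /=; apply: leq_sum => S; rewrite inE => /eqP cS.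
  (* The degree n^3 is split as q k with q = n and threshold k = n^2. *)
  have e : s = n * n ^ 2 by rewrite -expnS.
  have n20 : 0 < n ^ 2 by rewrite expn_gt0 n0.
  have degV v : #|nbhd S v| <= n * n ^ 2 by rewrite card_nbhd cS e.
  have degW w : n * n ^ 2 <= #|[set v | w \in nbhd S v]|.
    rewrite -e -cS -(card_nbhd S w); apply/subset_leq_card/subsetP => v.
    by rewrite !inE addrC.
  have := card_indep_pairs setT setT n20 (expn_sqr_step n0) (double_expn n0) degV degW.
  rewrite cardsT !expnD !expnMn mulnC /s.
  by apply: etrans; congr (_ <= _); ring.
by rewrite sum_nat_const card_draws leq_mul2r bin_leq_expn orbT.
Qed.

Definition large_triples (s : nat) : {set {set G} * {set G} * {set G}} :=
  [set t : {set G} * {set G} * {set G} |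
    [&& s <= #|t.1.1|, s <= #|t.1.2|, s <= #|t.2| & zero_free t.1.1 t.1.2 t.2]].

Lemma card_large_triples s : #|large_triples s| ^ 2 <= #|extendable_pairs s| ^ 3.
Proof.
apply: leq_trans (loomis_whitney _); apply/leq_wexp2r/subset_leq_card/subsetP.
move=> [[A B] C]; rewrite !inE /= => /and4P[sA sB sC h].
apply/and3P; split; apply/existsP.
- by exists C; rewrite sC zero_free_perm12 zero_free_perm23.
- by exists B; rewrite sB zero_free_perm12.
- by exists A; rewrite sA.
Qed.

(** Given [B], the set [C] ranges over the subsets of the image of the complement of [B] under y ->
    - (x + y). *)
Lemma card_zero_free1 x :
  #|[set P : {set G} * {set G} | zero_free [set x] P.1 P.2]| = 3 ^ #|G|.
Proof.
have -> : #|[set P : {set G} * {set G} | zero_free [set x] P.1 P.2]|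
    = \sum_(B : {set G}) 2 ^ #|~: B|.
  under eq_bigr => B _.
    rewrite -[#|~: B|](card_imset _ (f := fun y => - (x + y))%R); last first.
      by move=> a b /oppr_inj /addrI.
    rewrite -card_powerset -sum1_card; over.
  rewrite pair_big_dep /= -sum1_card; apply: eq_bigl => -[B C] /=; rewrite !inE.
  apply/zero_freeP/subsetP => /= [h z zC | h _ y z /set1P-> yB zC].
    apply/imsetP; exists (- (x + z))%R; last by rewrite opprD opprK addKr.
    rewrite inE; apply/negP => yB; have := h x _ z (set11 x) yB zC.
    by rewrite addrAC subrr eqxx.
  have /imsetP[y' + e] := h z zC; rewrite inE; apply: contra.
  by rewrite e subr_eq0 => /eqP/addrI <-.
(* Expand the product of |G| factors 1 + 2 over subsets [B]: elements of [B] contribute 1, the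
   others 2. *)
rewrite -[3]/(1 + 2) -prod_nat_const bigA_distr; apply: eq_bigr => B _.
rewrite -prod_nat_const big_mkcond; apply: eq_bigr => i _; rewrite inE.
by case: (i \in B).
Qed.

End ZeroFree.

(** The halves of [u] describe consecutive terms w and w + d: is the term in [B], and is - (x +
    term) in [C]? The first two clauses come from x, the last from x', because x' + (w + d) = x +
    w. *)
Definition block_ok (u : bool * bool * (bool * bool)) : bool :=
  [&& ~~ (u.1.1 && u.1.2), ~~ (u.2.1 && u.2.2) & ~~ (u.1.2 && u.2.1)].

Lemma card_block_ok : #|block_ok| = 8.
Proof.
have sum_bool2 (f : bool * bool -> nat) :
    \sum_u f u = f (true, true) + f (true, false) + (f (false, true) + f (false, false)).
  rewrite (eq_bigr (fun u => f (u.1, u.2))) => [|[a b]] //.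
  by rewrite -(pair_bigA _ (fun a b => f (a, b))) !big_bool.
rewrite -sum1_card big_mkcond -(pair_bigA _ (fun a b => if (a, b) \in block_ok then 1 else 0)).
by rewrite !sum_bool2.
Qed.

(* Cut the progression [0, d, 2d, ...] with [d = x - x'] into pairs of
   consecutive terms: on each pair only 8 of the 16 patterns of membership in [B]
   and in [- x - C] occur. *)
Lemma card_zero_free2 (p : nat) (A : {set 'F_p}) : prime p -> odd p -> 1 < #|A| ->
  #|[set P : {set 'F_p} * {set 'F_p} | zero_free A P.1 P.2]| <= 8 ^ p./2 * 4.
Proof.
move=> pr_p odd_p /card_gt1P[x [x' [xA x'A neq_x]]].
pose d := (x - x')%R; pose v j : 'F_p := (d *+ j)%R.
pose st (P : {set 'F_p} * {set 'F_p}) j := (v j \in P.1, (- (x + v j))%R \in P.2).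
(* As p is odd, the pairs (2i, 2i + 1) miss only the term p - 1, which is recorded without
   constraint and costs the factor 4. *)
pose code P := ([ffun i : 'I_p./2 => (st P i.*2, st P i.*2.+1)], st P p.-1).
have d0 : d != 0%R by rewrite subr_eq0.
have v_onto w : exists2 j, j < p & w = v j.
  exists (w / d)%R; first by have := ltn_ord (w / d)%R; rewrite [X in _ < X -> _](Fp_cast pr_p).
  by rewrite /v -[RHS](mulr_natr d) natr_Zp mulrC divfK.
have code_inj : injective code.
  move=> P P' e; have /ffunP e2 := congr1 fst e; have /= e1 := congr1 snd e.
  have est j : j < p -> st P j = st P' j.
    move=> lt_jp; have [->|neq_j] := eqVneq j p.-1; first exact: e1.
    have lt_j2 : j./2 < p./2 by lia.
    have := e2 (Ordinal lt_j2); rewrite !ffunE => e3.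
    have /= eF := congr1 fst e3; have /= eS := congr1 snd e3.
    by rewrite -(odd_double_half j); case: (odd j).
  case: P P' est {e e1 e2} => [B C] [B' C'] est; congr pair; apply/setP => w.
    by have [j /est[+ _] ->] := v_onto w.
  (* Membership of w in [C] is recorded at the term - (x + w), since y -> - (x + y) is an
     involution. *)
  have [j /est[_ +] e] := v_onto (- (x + w))%R.
  by rewrite /= -e opprD opprK addKr.
rewrite -(card_imset _ code_inj).
have -> : 8 ^ p./2 * 4 =
    #|setX [set f : {ffun 'I_p./2 -> bool * bool * (bool * bool)} | f \in ffun_on block_ok]
            [set: bool * bool]|.
  by rewrite cardsX cardsE card_ffun_on card_block_ok card_ord cardsT card_prod card_bool.
apply/subset_leq_card/subsetP => _ /imsetP[[B C] + ->].
rewrite !inE /= andbT => /zero_freeP h; apply/ffun_onP => i; rewrite ffunE.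
have hx j : v j \in B -> (- (x + v j))%R \in C -> False.
  by move=> vB vC; have := h x _ _ xA vB vC; rewrite subrr eqxx.
apply/and3P; split; apply/negP => /= /andP[]; try exact: hx.
move=> vC vB; have := h x' _ _ x'A vB vC.
by rewrite /v mulrS addrA [(x' + d)%R]addrC subrK subrr eqxx.
Qed.

Definition neg_third (p : nat) (t : {set 'F_p} * {set 'F_p} * {set 'F_p}) :=
  (t.1, [set - x | x in t.2]%R).

Lemma T_zero_free (p : nat) :
  T p = #|[set t : {set 'F_p} * {set 'F_p} * {set 'F_p} | zero_free t.1.1 t.1.2 t.2]|.
Proof.
have opK : involutive (fun C : {set 'F_p} => [set - x | x in C]%R).
  move=> C; rewrite -imset_comp -[RHS]imset_id; apply: eq_imset => x /=; exact: opprK.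
have nK : involutive (@neg_third p) by move=> [AB C]; rewrite /neg_third /= opK.
rewrite /T -[RHS](card_imset _ (inv_inj nK)); apply: eq_card => t.
rewrite inE; apply/idP/imsetP => [h | [t' + ->]].
  exists (neg_third t); rewrite ?nK // inE; apply/zero_freeP => x y z xA yB /imsetP[z' zC ->].
  have /forall_inP/(_ x xA)/forall_inP/(_ y yB)/forall_inP/(_ z' zC) := h.
  by rewrite subr_eq0.
rewrite inE => /zero_freeP h; apply/forall_inP => x xA; apply/forall_inP => y yB.
apply/forall_inP => _ /imsetP[z zC ->]; rewrite -subr_eq0 opprK; exact: h.
Qed.

(** * Counting triples by the sizes of their members *)

Section Slices.

Variable G : finZmodType.
Implicit Types (a : pred nat) (t : {set G} * {set G} * {set G}).

Definition zero_free_triples : {set {set G} * {set G} * {set G}} :=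
  [set t | zero_free t.1.1 t.1.2 t.2].
Definition slice1 a := [set t in zero_free_triples | a #|t.1.1|].
Definition slice2 a := [set t in zero_free_triples | a #|t.1.2|].
Definition slice3 a := [set t in zero_free_triples | a #|t.2|].

Lemma card_slice2 a : #|slice2 a| = #|slice1 a|.
Proof.
pose f t := (t.1.2, t.1.1, t.2); have fK : involutive f by move=> [[]].
rewrite -[RHS](card_imset _ (inv_inj fK)) (can2_imset_pre _ fK fK).
by apply: eq_card => -[[A B] C]; rewrite !inE /= zero_free_perm12.
Qed.

Lemma card_slice3 a : #|slice3 a| = #|slice2 a|.
Proof.
pose f t := (t.1.1, t.2, t.1.2); have fK : involutive f by move=> [[]].
rewrite -[RHS](card_imset _ (inv_inj fK)) (can2_imset_pre _ fK fK).
by apply: eq_card => -[[A B] C]; rewrite !inE /= zero_free_perm23.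
Qed.

Lemma card_slice1 a :
  #|slice1 a| = \sum_(A : {set G} | a #|A|)
                   #|[set P : {set G} * {set G} | zero_free A P.1 P.2]|.
Proof.
rewrite card_triples [RHS]big_mkcond; apply: eq_bigr => A _; case: ifP => aA.
  by apply: eq_card => P; rewrite !inE /= aA andbT.
by apply: eq_card0 => P; rewrite !inE /= aA andbF.
Qed.

Lemma card_all_subsets : #|{: {set G}}| = 2 ^ #|G|.
Proof. by rewrite -[LHS]cardsT -powersetT card_powerset cardsT. Qed.

Definition le1 : pred nat := fun m => m <= 1.

(** The empty set is compatible with all 4^|G| pairs and each singleton with 3^|G|; three such
    slices make up the main term. *)
Lemma card_slice1_le1 : #|slice1 le1| = 4 ^ #|G| + #|G| * 3 ^ #|G|.
Proof.
rewrite card_slice1 (bigD1 set0) /le1 ?cards0 //=; congr addn.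
  rewrite (_ : [set P | _] = setT).
    by rewrite cardsT card_prod !card_all_subsets -expnMn.
  by apply/setP => P; rewrite !inE; apply/zero_freeP => x y z; rewrite inE.
rewrite (eq_bigl (mem (set1 @: [set: G]))); last first.
  move=> A /=; rewrite -card_gt0; apply/andP/imsetP => [[A1 A0] | [x _ ->]].
    have /cards1P[x ->] : #|A| == 1 by rewrite eqn_leq A1.
    by exists x.
  by rewrite cards1.
rewrite big_imset /=; last by move=> x y _ _; apply: set1_inj.
under eq_bigr => x _ do rewrite card_zero_free1.
by rewrite sum_nat_const cardsT.
Qed.

Let few := [set A : {set G} | #|A| < 2].

Lemma card_slice12 : #|slice1 le1 :&: slice2 le1| <= (2 * #|G| ^ 2) ^ 2 * 2 ^ #|G|.
Proof.
have G0 : 0 < #|G| by rewrite (cardD1 0%R).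
apply: (@leq_trans #|setX (setX few few) [set: {set G}]|).
  apply/subset_leq_card/subsetP => -[[A B] C]; rewrite !inE /= /le1 andbT.
  by case/andP=> /andP[_ A1] /andP[_ B1]; rewrite !ltnS A1.
rewrite !cardsX cardsT card_all_subsets mulnn leq_mul2r.
by rewrite leq_wexp2r ?orbT // card_subsets_lt.
Qed.

Lemma card_slice13 : #|slice1 le1 :&: slice3 le1| <= (2 * #|G| ^ 2) ^ 2 * 2 ^ #|G|.
Proof.
apply: leq_trans card_slice12.
pose f t := (t.1.1, t.2, t.1.2); have fK : involutive f by move=> [[]].
rewrite -(card_imset _ (inv_inj fK)) (can2_imset_pre _ fK fK).
apply/subset_leq_card/subsetP => -[[A B] C].
by rewrite !inE /= [in X in X -> _]zero_free_perm23.
Qed.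

Lemma card_slice23 : #|slice2 le1 :&: slice3 le1| <= (2 * #|G| ^ 2) ^ 2 * 2 ^ #|G|.
Proof.
apply: leq_trans card_slice13.
pose f t := (t.1.2, t.1.1, t.2); have fK : involutive f by move=> [[]].
rewrite -(card_imset _ (inv_inj fK)) (can2_imset_pre _ fK fK).
apply/subset_leq_card/subsetP => -[[A B] C].
by rewrite !inE /= [in X in X -> _]zero_free_perm12.
Qed.

(** Bonferroni: the union of the three slices has at least the sum of their sizes minus the three
    pairwise overlaps. *)
Lemma card_zero_free_triples_ge :
  3 * (4 ^ #|G| + #|G| * 3 ^ #|G|)
    <= #|zero_free_triples| + 3 * ((2 * #|G| ^ 2) ^ 2 * 2 ^ #|G|).
Proof.
have := card_slice12; have := card_slice13; have := card_slice23.
have : #|slice1 le1 :|: slice2 le1 :|: slice3 le1| <= #|zero_free_triples|.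
  by apply/subset_leq_card; rewrite !subUset; apply/andP; split; [apply/andP; split|];
    apply/subsetP => t; rewrite inE => /andP[].
have := cardsUI (slice1 le1 :|: slice2 le1) (slice3 le1).
have := cardsUI (slice1 le1) (slice2 le1).
have := leq_card_setU (slice1 le1 :&: slice3 le1) (slice2 le1 :&: slice3 le1).
rewrite -setIUl -card_slice1_le1 => -[+ _].
have := card_slice2 le1; have := card_slice3 le1.
lia.
Qed.

Lemma card_zero_free_triples_le s :
  #|zero_free_triples| <= 3 * (4 ^ #|G| + #|G| * 3 ^ #|G|)
    + 3 * #|slice1 (fun m => 1 < m < s)| + #|@large_triples G s|.
Proof.
pose mid m := 1 < m < s; rewrite -/mid.
(* Some member has at most one element, or some member has size strictly between 1 and s, or all
   have at least s elements. *)
have cover : zero_free_triples \subset (slice1 le1 :|: slice2 le1 :|: slice3 le1)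
    :|: (slice1 mid :|: slice2 mid :|: slice3 mid) :|: @large_triples G s.
  apply/subsetP => t; rewrite !inE /mid /le1 => -> /=; rewrite !andbT; lia.
have := subset_leq_card cover; rewrite -card_slice1_le1.
have U X Y := (leq_card_setU X Y : #|X :|: Y| <= #|X| + #|Y|).
move=> /leq_trans/(_ (U _ _ _)).
have := U _ (slice1 le1 :|: slice2 le1 :|: slice3 le1) (slice1 mid :|: slice2 mid :|: slice3 mid).
have := U _ (slice1 le1 :|: slice2 le1) (slice3 le1); have := U _ (slice1 le1) (slice2 le1).
have := U _ (slice1 mid :|: slice2 mid) (slice3 mid); have := U _ (slice1 mid) (slice2 mid).
rewrite !(card_slice3, card_slice2); lia.
Qed.

End Slices.

Lemma card_slice1_mid (p s : nat) : prime p -> odd p ->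
  #|@slice1 'F_p (fun m => 1 < m < s)| <= s * p ^ s * (8 ^ p./2 * 4).
Proof.
move=> pr_p odd_p; rewrite card_slice1.
apply: (@leq_trans (\sum_(A in [set A : {set 'F_p} | #|A| < s]) 8 ^ p./2 * 4)).
  rewrite big_mkcond [leqRHS]big_mkcond; apply: leq_sum => A _; rewrite inE.
  by case: ifP => // /andP[A1 ->]; apply: card_zero_free2.
rewrite sum_nat_const leq_mul2r; apply/orP; right.
by have := @card_subsets_lt 'F_p s; rewrite card_Fp //; apply; apply: prime_gt0.
Qed.


(** * Bounds over the prime field *)

Section Bounds.

Variable p : nat.
Hypothesis pr_p : prime p.

Lemma T_lower : 3 * (4 ^ p + p * 3 ^ p) <= T p + 3 * ((2 * p ^ 2) ^ 2 * 2 ^ p).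
Proof.
by have := card_zero_free_triples_ge 'F_p; rewrite card_Fp // T_zero_free.
Qed.

Lemma T_upper s : odd p ->
  T p <= 3 * (4 ^ p + p * 3 ^ p) + 3 * (s * p ^ s * (8 ^ p./2 * 4))
         + #|@large_triples 'F_p s|.
Proof.
move=> odd_p; have := card_zero_free_triples_le 'F_p s.
rewrite card_Fp // -T_zero_free; have := card_slice1_mid s pr_p odd_p; lia.
Qed.

Lemma card_large_triples_Fp n : 0 < n ->
  #|@large_triples 'F_p (n ^ 3)| ^ 2 * ((n ^ 3) ^ p) ^ 3
    <= (p ^ (n ^ 3) * (2 * n.+1 ^ 3) ^ p) ^ 3.
Proof.
move=> n0; apply: leq_trans (leq_mul (card_large_triples _ _) (leqnn _)) _.
rewrite -expnMn leq_wexp2r //.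
by have := @card_extendable_pairs 'F_p n n0; rewrite card_Fp.
Qed.

End Bounds.

(** * Real estimates *)

From Stdlib Require Import Reals Lra.
(* [Reals] gives the key [N] to binary numbers and [^] on [nat] to [Nat.pow]. *)
Delimit Scope nat_scope with N.
Local Open Scope R_scope.

Lemma INR_expn (m n : nat) : INR (expn m n) = INR m ^ n.
Proof. by elim: n => // n IH; rewrite expnS -multE mult_INR IH. Qed.

Lemma INR_muln (m n : nat) : INR (m * n)%N = INR m * INR n.
Proof. by rewrite -multE mult_INR. Qed.

Lemma INR_addn (m n : nat) : INR (m + n)%N = INR m + INR n.
Proof. by rewrite -plusE plus_INR. Qed.

Lemma INR_leq (m n : nat) : (m <= n)%N -> INR m <= INR n.
Proof. by move=> /leP; apply: le_INR. Qed.

(** Induction on k with b split as sqrt b * sqrt b: one factor absorbs p^k by induction, the other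
    absorbs p by Bernoulli's inequality. *)
Lemma pow_le_exponential (k : nat) (b : R) : 1 < b ->
  exists K : R, 0 < K /\ forall p : nat, INR p ^ k <= K * b ^ p.
Proof.
elim: k b => [|k IH] b b1.
  exists 1; split=> [|p]; first lra.
  have := pow_R1_Rle b p; rewrite /=; lra.
have r1 : 1 < sqrt b by rewrite -sqrt_1; apply: sqrt_lt_1; lra.
have [K [K0 HK]] := IH _ r1.
have e0 : 0 < sqrt b - 1 by lra.
exists (K / (sqrt b - 1)); split=> [|p]; first exact: Rdiv_lt_0_compat.
have bern : INR p * (sqrt b - 1) <= sqrt b ^ p.
  have := poly p _ e0; rewrite (_ : 1 + (sqrt b - 1) = sqrt b); lra.
have -> : K / (sqrt b - 1) * b ^ p = (K * sqrt b ^ p) * (sqrt b ^ p / (sqrt b - 1)).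
  rewrite -{2}(sqrt_def b) ?Rpow_mult_distr; [field | ]; lra.
rewrite /= Rmult_comm; apply: Rmult_le_compat => //.
- by apply: pow_le; apply: pos_INR.
- exact: pos_INR.
by apply: (Rmult_le_reg_r (sqrt b - 1)) => //; field_simplify; lra.
Qed.

Lemma le_of_pow2_le (x y : R) : 0 <= y -> x ^ 2 <= y ^ 2 -> x <= y.
Proof. by move=> y0 h; apply: Rnot_lt_le => yx; nra. Qed.

Lemma pow_pow (x : R) m n : (x ^ m) ^ n = (x ^ n) ^ m.
Proof. by rewrite -!pow_mult Nat.mul_comm. Qed.

(** Keeps n abstract, so that n^3 is never expanded as a unary numeral. *)
Lemma exists_INR100 : exists n, (0 < n)%N /\ INR n = 100.
Proof. by exists 100%N; split => //; rewrite /=; lra. Qed.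

Lemma pow8_half_le p : INR (expn 8 p./2) <= (284 / 100) ^ p.
Proof.
rewrite -{2}(odd_double_half p) -addnn INR_expn !pow_add -Rpow_mult_distr.
(* 2.84 is just above the square root of 8. *)
have le8 : INR 8 <= 284 / 100 * (284 / 100) by rewrite /=; lra.
have h : INR 8 ^ p./2 <= (284 / 100 * (284 / 100)) ^ p./2.
  by apply: pow_incr; split => //; apply: pos_INR.
have : 1 <= (284 / 100) ^ odd p by apply: pow_R1_Rle; lra.
have : 0 <= INR 8 ^ p./2 by apply: pow_le; apply: pos_INR.
nra.
Qed.

Lemma poly_pow_le (k : nat) (a b : R) : 0 < a < b ->
  exists K, 0 < K /\ forall p : nat, INR p ^ k * a ^ p <= K * b ^ p.
Proof.
move=> [a0 ab]; have ba1 : 1 < b / a.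
  by apply: (Rmult_lt_reg_r a) => //; field_simplify; lra.
have [K [K0 HK]] := pow_le_exponential k ba1; exists K; split=> // p.
have -> : b = b / a * a by field; lra.
rewrite Rpow_mult_distr -Rmult_assoc; apply: Rmult_le_compat_r => //.
by apply: pow_le; lra.
Qed.

Lemma large_triples_le n : (0 < n)%N -> INR n = 100 ->
  exists K, 0 < K /\ forall p, prime p ->
    INR #|@large_triples 'F_p (expn n 3)| <= K * (299 / 100) ^ p.
Proof.
(* The squared count is at most p^(3s) q^p with s = n^3. The choice n = 100 gives q < 8.75, below
   2.99^2 = 8.9401. *)
move=> n0 en; pose q := (2 * 101 ^ 3 / 100 ^ 3) ^ 3.
have [|K [K0 HK]] := @poly_pow_le (expn n 3 * 3) q ((299 / 100) ^ 2).
  by rewrite /q; lra.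
(* K <= (K + 1)^2 avoids taking the square root of K. *)
exists (K + 1); split=> [|p pr_p]; first lra.
have := INR_leq (card_large_triples_Fp pr_p n0).
rewrite !(INR_muln, INR_expn) (S_INR n) en (_ : INR 2 = 2) //.
move: (INR #|_|) HK => L HK; move: (expn n 3) HK => s HK hL.
have B0 : 0 < (299 / 100) ^ p by apply: pow_lt; lra.
apply: le_of_pow2_le; first by apply: Rmult_le_pos; lra.
apply: (@Rle_trans _ (K * ((299 / 100) ^ p) ^ 2)); last first.
  by rewrite Rpow_mult_distr; apply: Rmult_le_compat_r; nra.
rewrite [(_ ^ p) ^ 2]pow_pow; apply: Rle_trans (HK p).
have c0 : 0 < ((100 ^ 3) ^ p) ^ 3 by do 2 apply: pow_lt; lra.
apply: (Rmult_le_reg_r _ _ _ c0); apply: Rle_trans hL _.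
right; rewrite (pow_mult _ s 3) /q [in RHS](pow_pow _ 3 p) -!Rpow_mult_distr.
by rewrite Rmult_assoc -Rpow_mult_distr; do 3 f_equal; field.
Qed.

Lemma mid_triples_le s :
  exists K, 0 < K /\ forall p,
    INR (muln (muln s (expn p s)) (muln (expn 8 p./2) 4)) <= K * (299 / 100) ^ p.
Proof.
have [|K [K0 HK]] := @poly_pow_le s (284 / 100) (299 / 100); first lra.
(* The summand 1 keeps the constant positive even when s = 0. *)
exists (INR s * 4 * K + 1); split=> [|p].
  have := pos_INR s; nra.
rewrite !INR_muln INR_expn (_ : INR 4 = 4); last by rewrite /=; lra.
have := HK p; have := pow8_half_le p.
have B0 : 0 < (299 / 100) ^ p by apply: pow_lt; lra.
have := pos_INR s; have : 0 <= INR p ^ s by apply: pow_le; apply: pos_INR.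
move: (INR p ^ s) (INR s) (INR (expn _ _)) => P S X P0 S0 hX hP.
have : S * 4 * (P * X) <= S * 4 * (K * (299 / 100) ^ p).
  by apply: Rmult_le_compat_l; [nra | apply: Rle_trans hP; nra].
nra.
Qed.

Lemma overlap_le :
  exists K, 0 < K /\ forall p,
    INR (muln (expn (muln 2 (expn p 2)) 2) (expn 2 p)) <= K * (299 / 100) ^ p.
Proof.
have [|K [K0 HK]] := @poly_pow_le 4 2 (299 / 100); first lra.
exists (4 * K); split=> [|p]; first lra.
rewrite !(INR_muln, INR_expn) (_ : INR 2 = 2) //; have := HK p; rewrite /=; nra.
Qed.

Lemma Rabs_INR_sub_le (t f m l g : nat) :
  (t <= f + 3 * m + l)%N -> (f <= t + 3 * g)%N ->
  Rabs (INR t - INR f) <= INR l + 3 * INR m + 3 * INR g.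
Proof.
move=> /INR_leq; rewrite (INR_addn (f + _)%N) (INR_addn f) INR_muln => up.
move=> /INR_leq; rewrite (INR_addn t) INR_muln => lo.
have e3 : INR 3 = 3 by rewrite /=; lra.
rewrite e3 in up lo; have := pos_INR m; have := pos_INR l; have := pos_INR g.
by move=> *; apply: Rabs_le; lra.
Qed.

Theorem theorem14 :
  exists (cstar K : R) (p0 : nat),
    (0 < cstar)%R /\ (0 < K)%R /\
    forall p : nat, prime p -> (p0 <= p)%N ->
      (Rabs (INR (T p) - 3 * 4 ^ p - 3 * INR p * 3 ^ p) <= K * (3 - cstar) ^ p)%R.
Proof.
have [n [n0 en]] := exists_INR100.
have [K1 [K10 H1]] := large_triples_le n0 en.
have [K2 [K20 H2]] := mid_triples_le (expn n 3).
have [K3 [K30 H3]] := overlap_le.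
(* All three error terms are O(2.99^p), weighted as in [Rabs_INR_sub_le]; p >= 3 makes the prime
   odd. *)
exists (1 / 100), (K1 + 3 * K2 + 3 * K3), 3%N; do 2 (split; first lra).
move=> p pr_p p3; have odd_p : odd p by case: (even_prime pr_p) p3 => // ->.
rewrite (_ : 3 - 1 / 100 = 299 / 100); last lra.
have e3 : INR 3 = 3 by rewrite /=; lra.
have e4 : INR 4 = 4 by rewrite /=; lra.
have main_term : INR (muln 3 (addn (expn 4 p) (muln p (expn 3 p))))
    = 3 * 4 ^ p + 3 * INR p * 3 ^ p.
  by rewrite INR_muln INR_addn INR_muln !INR_expn e3 e4; lra.
have := Rabs_INR_sub_le (T_upper pr_p (expn n 3) odd_p) (T_lower pr_p).
rewrite main_term /Rminus Ropp_plus_distr -Rplus_assoc => /Rle_trans; apply.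
have := H1 p pr_p; have := H2 p; have := H3 p; lra.
Qed.
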